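(* Let $L$ and $M$ be two (ground) LP$^{\text{MLN}}$ programs. Then: (i) $L$ and $M$ are p-strongly equivalent if and only if $LSE(L)=LSE(M)$ and there exist two constants $c$ and $k$ such that for every SE-model $(X,Y)\in LSE(L)$, $W(L,(X,Y)) = \exp(c+k\alpha)\cdot W(M,(X,Y))$; (ii) $L$ and $M$ are w-strongly equivalent if and only if they are p-strongly equivalent and the constants in (i) can be taken to be $c=k=0$.
   Context: A literal is an atom $a$ or its classical negation; a set of literals is consistent if it does not contain an atom together with its negation. A ground ASP rule $r$ has the form $l_1\vee\dots\vee l_k\leftarrow l_{k+1},\dots,l_m,\ not\ l_{m+1},\dots,not\ l_n$ with literals $l_i$; $h(r)=\{l_1,\dots,l_k\}$, $b^+(r)=\{l_{k+1},\dots,l_m\}$, $b^-(r)=\{l_{m+1},\dots,l_n\}$. A consistent set $X$ satisfies $r$ if $b^+(r)\subseteq X$ and $b^-(r)\cap X=\emptyset$ imply $h(r)\cap X\neq\emptyset$; $X$ satisfies a set of rules if it satisfies each. The GL-reduct of an ASP program $P$ w.r.t. $X$ is $P^X=\{h(r)\leftarrow b^+(r) \mid r\in P,\ b^-(r)\cap X=\emptyset\}$; $X$ is a stable model of $P$ if $X$ is consistent, satisfies $P^X$, and no proper subset of $X$ satisfies $P^X$. An LP$^{\text{MLN}}$ program is a finite set of ground weighted rules $w:r$, where $r$ is an ASP rule and $w$ is either a real number (soft rule) or the symbol $\alpha$ denoting infinite weight (hard rule). For such a program $M$: $\overline{M}=\{r\mid w:r\in M\}$; $W(M)=\exp(\sum_{w:r\in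 M}w)$ (a formal expression in $\alpha$); for a consistent set $X$, $M_X=\{w:r\in M\mid X \text{ satisfies } r\}$. $X$ is a stable model of $M$ if $X$ is a stable model of the ASP program $\overline{M_X}$; $SM(M)$ is the set of stable models. For $X\in SM(M)$, $W(M,X)=W(M_X)$ and $P(M,X)=\lim_{\alpha\to\infty} W(M,X)/\sum_{X'\in SM(M)}W(M,X')$. Two programs $L,M$ are w-ordinarily equivalent if $SM(L)=SM(M)$ and $W(L,X)=W(M,X)$ for every stable model $X$; p-ordinarily equivalent if $SM(L)=SM(M)$ and $P(L,X)=P(M,X)$ for every stable model $X$. They are w-strongly (resp. p-strongly) equivalent if for every LP$^{\text{MLN}}$ program $N$, $L\cup N$ and $M\cup N$ are w-ordinarily (resp. p-ordinarily) equivalent. An SE-interpretation is a pair $(X,Y)$ of consistent sets of literals with $X\subseteq Y$. It is an SE-model of $M$ if both $X$ and $Y$ satisfy the ASP program $(\overline{M_Y})^Y$. $LSE(M)$ denotes the set of SE-models of $M$, and for $(X,Y)\in LSE(M)$, $W(M,(X,Y))=W(M_Y)=\exp(\sum_{w:r\in M_Y}w)$.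
   Formalization: Programs (including the added program N) are finite multisets of weighted rules and the union of programs is the multiset sum, so shared weighted rules count twice; with ordinary idempotent set union the sufficiency direction is false. *)

(* Defs.v *)
From HB Require Import structures.
From mathcomp Require Import all_boot all_order all_algebra.
From mathcomp Require Import finmap multiset.
From mathcomp Require Import all_classical all_reals all_analysis.

Set Implicit Arguments.
Unset Strict Implicit.
Unset Printing Implicit Defensive.

Import Order.TTheory GRing.Theory Num.Theory.
Import numFieldNormedType.Exports.

Local Open Scope classical_set_scope.
Local Open Scope ring_scope.

(* [(a, true)] is the atom [a], [(a, false)] its classical negation. *)
Definition literal (A : choiceType) := (A * bool)%type.

Definition consistent (A : choiceType) (X : set (literal A)) : Prop :=
  forall a : A, ~ (X (a, true) /\ X (a, false)).

(* A ground rule is the triple (h(r), b^+(r), b^-(r)). *)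
Definition rule (A : choiceType) :=
  ({fset literal A} * {fset literal A} * {fset literal A})%type.

Section ASP.
Variable A : choiceType.
Implicit Types (r : rule A) (P : set (rule A)) (X : set (literal A)).

Definition head r : {fset literal A} := r.1.1.
Definition pbody r : {fset literal A} := r.1.2.
Definition nbody r : {fset literal A} := r.2.

Definition satisfies X r : Prop :=
  [set` pbody r] `<=` X -> [set` nbody r] `&` X = set0 ->
  [set` head r] `&` X !=set0.

Definition satisfies_all X P : Prop := forall r, P r -> satisfies X r.

Definition reduct P X : set (rule A) :=
  [set (head r, pbody r, fset0 : {fset literal A})
     | r in [set r | P r /\ [set` nbody r] `&` X = set0]].

Definition asp_stable P X : Prop :=
  [/\ consistent X, satisfies_all X (reduct P X)
    & forall X', X' `<` X -> ~ satisfies_all X' (reduct P X)].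

End ASP.

(* The weight [Some w] is the real w (soft rule), [None] is the symbol alpha
   (hard rule). *)
Definition wrule (R : realType) (A : choiceType) := (option R * rule A)%type.

(* Programs are finite multisets of weighted rules and the union of two programs
   is the multiset sum, which is the set union when no weighted rule is shared.
   This is what makes W(L U N, X) = W(L, X) W(N, X).  With idempotent set union
   the strong equivalence theorem fails: take L = {1 : a <- b, not a},
   M = {1 : <- b, not a} and N = L U {0 : a, 0 : b}.  L and M have the same
   SE-models with the same weights, but the stable models {a, b} and {b} have
   weights e and 1 in the set union of L and N, and e^2 and 1 in that of
   M and N. *)
Definition program (R : realType) (A : choiceType) := {mset wrule R A}%mset.

Section LPMLN.
Variables (R : realType) (A : choiceType).
Implicit Types (L M N : program R A) (X Y : set (literal A)).

Definition punion L M : program R A := (L `+` M)%mset.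

Definition unweighted M : set (rule A) :=
  [set r | exists w : option R, (w, r) \in enum_mset M].

(* M_X *)
Definition restr M X : program R A :=
  seq_mset [seq wr <- enum_mset M | `[< satisfies X wr.2 >]].

(* The formal expression W(M) in alpha is the function sending a value of alpha
   to the value of the expression: exp(c + k alpha) and exp(c' + k' alpha) are
   the same function of alpha iff c = c' and k = k'. *)
Definition W M (alpha : R) : R :=
  expR (\sum_(wr <- enum_mset M) odflt alpha wr.1).

Definition SM M : set (set (literal A)) :=
  [set X | asp_stable (unweighted (restr M X)) X].

Definition Wsm M X : R -> R := W (restr M X).

(* SM M is finite, M being finite, so the finitely supported sum is the sum. *)
Definition Psm M X : R :=
  lim (Wsm M X alpha / (\sum_(X' \in SM M) Wsm M X' alpha)
       @[alpha --> +oo]).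

Definition w_ord_equiv L M : Prop :=
  SM L = SM M /\ forall X, SM L X -> Wsm L X = Wsm M X.

Definition p_ord_equiv L M : Prop :=
  SM L = SM M /\ forall X, SM L X -> Psm L X = Psm M X.

Definition w_strong_equiv L M : Prop :=
  forall N, w_ord_equiv (punion L N) (punion M N).

Definition p_strong_equiv L M : Prop :=
  forall N, p_ord_equiv (punion L N) (punion M N).

Definition se_interp (XY : set (literal A) * set (literal A)) : Prop :=
  [/\ consistent XY.1, consistent XY.2 & XY.1 `<=` XY.2].

Definition LSE M : set (set (literal A) * set (literal A)) :=
  [set XY | [/\ se_interp XY,
     satisfies_all XY.1 (reduct (unweighted (restr M XY.2)) XY.2)
   & satisfies_all XY.2 (reduct (unweighted (restr M XY.2)) XY.2)]].

Definition Wse M (XY : set (literal A) * set (literal A)) : R -> R :=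
  W (restr M XY.2).

Definition se_weights_proportional L M (c k : R) : Prop :=
  forall XY, LSE L XY ->
  forall alpha : R, Wse L XY alpha = expR (c + k * alpha) * Wse M XY alpha.

End LPMLN.

(* Main.v *)
(* Write M_Y for the rules of M satisfied by Y.  Since (Y,Y) is an SE-model of M
   for every consistent Y, the weight condition compares W(L_Y) and W(M_Y) for
   all consistent Y, and LSE(M) determines the stable models of all M U N.  This
   gives sufficiency: the factor exp(c + k alpha) cancels in the probabilities.

   Necessity of LSE(L) = LSE(M): if X, a proper subset of Y, satisfies the reduct
   of L_Y but not that of M_Y, add the facts X and the rules l <- m for l in Y
   and m in Y \ X; then Y is a stable model of the extension of M only.

   Necessity of the weight condition: let S be the set of literals of L and M.
   Adding all facts in S with weight 0 makes every consistent subset of S stable.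
   Adding also, for each subset Z of S, as many hard constraints
   <- Z, not (S \ Z) as there are hard rules in L_Z makes the weights of these
   stable models w.r.t. L have the same exponent of alpha, hence all probabilities
   are positive.  Positivity of the probabilities w.r.t. M forces equal exponents
   there too, and comparing the probabilities relates the soft parts. *)
Require Import Defs.
From HB Require Import structures.
From mathcomp Require Import all_boot all_order all_algebra.
From mathcomp Require Import finmap multiset.
From mathcomp Require Import all_classical all_reals all_analysis.
From mathcomp Require Import ring lra.
(* [all_boot] shadows [Defs.head] by [seq.head]. *)
Import Defs.

Set Implicit Arguments.
Unset Strict Implicit.
Unset Printing Implicit Defensive.

Import Order.TTheory GRing.Theory Num.Theory.
Import numFieldNormedType.Exports.

Local Open Scope classical_set_scope.
Local Open Scope ring_scope.

(** * Reducts, stable models and SE-models of restricted programs *)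

Section Basic.
Variables (R : realType) (A : choiceType).
Implicit Types (L M N : program R A) (X Y : set (literal A)) (r : rule A).

Lemma mem_restr M X (wr : wrule R A) :
  wr \in enum_mset (restr M X) <-> wr \in enum_mset M /\ satisfies X wr.2.
Proof.
rewrite (perm_mem (perm_eq_seq_mset _)) mem_filter andbC.
by split => [/andP[? /asboolP]|[-> /asboolP]].
Qed.

Lemma perm_punion L M :
  perm_eq (enum_mset (punion L M)) (enum_mset L ++ enum_mset M).
Proof.
apply/eq_seq_msetP/msetP => wr; rewrite !mset_seqE count_cat.
by rewrite -!mset_seqE !seq_mset_id msetE2.
Qed.

Lemma mem_punion L M (wr : wrule R A) :
  wr \in enum_mset (punion L M) <-> wr \in enum_mset L \/ wr \in enum_mset M.
Proof. by rewrite (perm_mem (perm_punion L M)) mem_cat; split => /orP. Qed.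

Definition sat_reduct M Y X : Prop :=
  satisfies_all X (reduct (unweighted (restr M Y)) Y).

Lemma sat_reductP M Y X : sat_reduct M Y X <->
  forall wr, wr \in enum_mset M -> satisfies Y wr.2 ->
    [set` nbody wr.2] `&` Y = set0 -> [set` pbody wr.2] `<=` X ->
    [set` head wr.2] `&` X !=set0.
Proof.
split => [h [w r] rM Yr nb pb|h _ [r [[w /mem_restr[rM Yr]] nb] <-] /= pb _].
  apply: (h (head r, pbody r, fset0)) => //=.
    by exists r => //; split => //; exists w; apply/mem_restr.
  by rewrite -subset0 => ? [].
exact: (h (w, r)).
Qed.

(** Holds for every [M] because [restr M Y] keeps only rules that [Y] satisfies. *)
Lemma sat_reduct_refl M Y : sat_reduct M Y Y.
Proof. by apply/sat_reductP => wr _ Ywr nb pb; apply: Ywr. Qed.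

Lemma sat_reduct_punion L M Y X :
  sat_reduct (punion L M) Y X <-> sat_reduct L Y X /\ sat_reduct M Y X.
Proof.
rewrite !sat_reductP.
split => [h|[hL hM] wr /mem_punion[]]; [|exact: hL|exact: hM].
by split => wr wrP; apply: h; apply/mem_punion; [left|right].
Qed.

Lemma SM_P M Y : SM M Y <->
  consistent Y /\ forall X, X `<` Y -> ~ sat_reduct M Y X.
Proof.
by split => [[? _ ?]|[? ?]]; split => //; apply: sat_reduct_refl.
Qed.

Lemma consistent_sub X Y : X `<=` Y -> consistent Y -> consistent X.
Proof. by move=> XY cY a [/XY ? /XY ?]; apply: (cY a). Qed.

Lemma LSE_P M X Y : LSE M (X, Y) <->
  [/\ consistent Y, X `<=` Y & sat_reduct M Y X].
Proof.
split => [[[_ cY XY] ? _]|[cY XY ?]]; split => //.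
- by split => //; apply: consistent_sub cY.
- exact: sat_reduct_refl.
Qed.

Lemma LSE_diag M Y : consistent Y -> LSE M (Y, Y).
Proof. by move=> cY; apply/LSE_P; split => //; apply: sat_reduct_refl. Qed.

Definition rule_lits r : {fset literal A} :=
  (head r `|` pbody r `|` nbody r)%fset.

Definition over (S : {fset literal A}) M : Prop :=
  forall wr, wr \in enum_mset M -> {subset rule_lits wr.2 <= S}.

Lemma overU S T M : over S M -> over (S `|` T)%fset M.
Proof. by move=> SM wr wrM l lr; rewrite in_fsetU (SM wr wrM l lr). Qed.

Lemma over_exists M : exists S, over S M.
Proof.
exists (\bigcup_(wr <- enum_mset M) rule_lits wr.2)%fset => wr wrM l lr.
by apply/bigfcupP; exists wr => //; rewrite wrM.
Qed.

Lemma over_punion S L M : over S L -> over S M -> over S (punion L M).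
Proof. by move=> SL SM wr /mem_punion[/SL|/SM]. Qed.

Lemma over_exists2 L M : exists S, over S L /\ over S M.
Proof.
have [S oS] := over_exists L; have [T oT] := over_exists M.
by exists (S `|` T)%fset; split; [exact: overU|rewrite fsetUC; exact: overU].
Qed.

(** * Restriction to a finite set of literals *)

Section Over.
Variable S : {fset literal A}.

Lemma restr_lits (B : {fset literal A}) X : {subset B <= S} ->
  [set` B] `&` X = [set` B] `&` (X `&` [set` S]).
Proof. move=> BS; rewrite eqEsubset; split => l /= [Bl]; last by case.
by move=> Xl; do !split => //; exact: BS. Qed.

Lemma sub_restr_lits (B : {fset literal A}) X : {subset B <= S} ->
  [set` B] `<=` X <-> [set` B] `<=` X `&` [set` S].
Proof.
by move=> BS; split => h l Bl; [split; [exact: h|exact: BS]|case: (h l Bl)].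
Qed.

Lemma rule_litsP r : {subset rule_lits r <= S} ->
  [/\ {subset head r <= S}, {subset pbody r <= S} & {subset nbody r <= S}].
Proof.
by move=> rS; split => l lr; apply: rS; rewrite /rule_lits !in_fsetU lr ?orbT.
Qed.

Lemma satisfies_restr r X : {subset rule_lits r <= S} ->
  satisfies X r <-> satisfies (X `&` [set` S]) r.
Proof.
by move=> /rule_litsP[hS pS nS]; rewrite /satisfies -!restr_lits// -sub_restr_lits.
Qed.

Lemma sat_reduct_restr M Y X : over S M ->
  sat_reduct M Y X <-> sat_reduct M (Y `&` [set` S]) (X `&` [set` S]).
Proof.
move=> SM; rewrite !sat_reductP; split => h wr wrM; have rS := SM _ wrM;
  have [hS pS nS] := rule_litsP rS; move: (h wr wrM);
  by rewrite -satisfies_restr// -!restr_lits// -sub_restr_lits.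
Qed.

(** The rules see only literals of [S], so the part of [Y] inside [S] satisfies the same reduct, and
    minimality of [Y] makes it all of [Y]. *)
Lemma SM_sub M Y : over S M -> SM M Y -> Y `<=` [set` S].
Proof.
move=> oS /SM_P[_ minY]; apply: contrapT => YS.
apply: (minY (Y `&` [set` S])).
  split; first exact: subIsetl.
  by move=> YYS; apply: YS => l /YYS[].
apply/(sat_reduct_restr Y _ oS); rewrite -setIA setIid.
by apply/(sat_reduct_restr _ _ oS)/sat_reduct_refl.
Qed.

Lemma sub_fsetP X : X `<=` [set` S] ->
  exists2 B : {fset literal A}, (B `<=` S)%fset & X = [set` B].
Proof.
move=> XS; have finX := sub_finite_set XS (finite_fset S).
exists (fset_set X); last by rewrite fset_setK.
by apply/fsubsetP => l; rewrite in_fset_set// inE; exact: XS.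
Qed.

Lemma finite_SM M : over S M -> finite_set (SM M).
Proof.
move=> oS; pose lits (B : {fset literal A}) := [set` B].
apply: sub_finite_set (finite_image lits (finite_fset (fpowerset S))).
by move=> Y /(SM_sub oS)/sub_fsetP[B BS ->]; exists B; rewrite //= fpowersetE.
Qed.

End Over.
End Basic.

(** * SE-models and stable models of extensions *)

Section SEModels.
Variables (R : realType) (A : choiceType).
Implicit Types (L M N : program R A) (X Y : set (literal A)).

(** A proper subset [X] of [Y] refuting minimality for [M] gives an SE-model [(X, Y)] of [M], hence
    of [L], and so refutes minimality for [L]. *)
Lemma SM_punion_LSE L M N : LSE L = LSE M ->
  SM (punion L N) `<=` SM (punion M N).
Proof.
move=> eqLM Y /SM_P[cY minY]; apply/SM_P; split => // X XY.
rewrite sat_reduct_punion => -[satM satN]; apply: (minY X XY).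
rewrite sat_reduct_punion; split => //.
have : LSE M (X, Y) by apply/LSE_P; split => //; case: XY.
by rewrite -eqLM => /LSE_P[].
Qed.

Definition fact (l : literal A) : rule A := ([fset l], fset0, fset0)%fset.

Definition facts (S : {fset literal A}) : seq (wrule R A) :=
  [seq (Some 0, fact l) | l <- S].

Definition impl (l m : literal A) : rule A := ([fset l], [fset m], fset0)%fset.

Definition impls (S T : {fset literal A}) : seq (wrule R A) :=
  [seq (Some 0, impl l m) | l <- S, m <- T].

Lemma mem_seq_mset (s : seq (wrule R A)) wr :
  (wr \in enum_mset (seq_mset s)) = (wr \in s).
Proof. exact: perm_mem (perm_eq_seq_mset _) _. Qed.

Lemma set1_meets X (l : literal A) : [set` [fset l]%fset] `&` X !=set0 <-> X l.
Proof.
by split => [[_ [/fset1P ->]]|Xl] //; exists l; split => //; exact: fset11.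
Qed.

Lemma sub_set1 X (l : literal A) : [set` [fset l]%fset] `<=` X <-> X l.
Proof. by split => [|Xl _ /fset1P ->] //; apply; exact: fset11. Qed.

Lemma fset0_meets X : [set` (fset0 : {fset literal A})] `&` X = set0.
Proof. by rewrite set_fset0 set0I. Qed.

Lemma satisfies_fact l X : X l -> satisfies X (fact l).
Proof. by move=> Xl _ _; apply/set1_meets. Qed.

(* Besides [Y] itself, [X] is the only subset of [Y] closed under these rules. *)
Lemma SM_facts_impls M (X Y : {fset literal A}) :
  consistent [set` Y] -> [set` X] `<` [set` Y] ->
  SM (punion M (seq_mset (facts X ++ impls Y (Y `\` X)%fset))) [set` Y] <->
  ~ sat_reduct M [set` Y] [set` X].
Proof.
move=> cY XY; set N := seq_mset _.
have satN (Z : set (literal A)) : sat_reduct N [set` Y] Z <->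
    [set` X] `<=` Z /\
    (forall l m, l \in Y -> m \in (Y `\` X)%fset -> Z m -> Z l).
  rewrite sat_reductP; split => [h|[XZ ZZ] wr].
    split => [l /= lX|l m lY mY Zm]; apply/set1_meets.
      apply: (h (Some 0, fact l)) => /=.
      - by rewrite mem_seq_mset mem_cat map_f.
      - by apply: satisfies_fact; exact: (properW XY).
      - exact: fset0_meets.
      - by [].
    apply: (h (Some 0, impl l m)) => /=.
    - rewrite mem_seq_mset mem_cat.
      by rewrite (allpairs_f (fun l m => (Some 0, impl l m))) ?orbT.
    - by move=> _ _; apply/set1_meets.
    - exact: fset0_meets.
    - exact/sub_set1.
  rewrite mem_seq_mset mem_cat.
  case/orP => [/mapP[l lX ->]|/allpairsP[[l m] [lY mY ->]]] /= _ _.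
    by move=> _; apply/set1_meets; exact: XZ.
  by move=> /sub_set1 Zm; apply/set1_meets; apply: (ZZ l m).
rewrite SM_P; split => [[_ minY] satX|nsatX].
  apply: (minY _ XY); apply/sat_reduct_punion; split => //.
  (* The implications are vacuous for [X], which contains no literal of their bodies. *)
  apply/satN; split => // l m.
  by rewrite in_fsetD => _ /andP[/negP].
split => // Z [ZY nYZ] /sat_reduct_punion[satM /satN[XZ ZZ]].
(* Either [Z] is [X], or some [m] of [Z] outside [X] triggers the implications and puts all of [Y]
   in [Z]. *)
have [ZX|/existsNP[m /not_implyP[Zm nXm]]] := pselect (Z `<=` [set` X]).
  by apply: nsatX; rewrite (_ : [set` X] = Z)// eqEsubset; split.
apply: nYZ => l lY; apply: (ZZ l m) => //.
by rewrite in_fsetD; apply/andP; split; [exact/negP|exact: ZY].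
Qed.

(** Intersecting [X] and [Y] with the literals of [L] and [M] makes them finite, so that the
    separating facts and implications form a program. *)
Lemma SM_punion_sat_reduct L M Y X :
  (forall N, SM (punion L N) `<=` SM (punion M N)) ->
  consistent Y -> X `<=` Y -> sat_reduct M Y X -> sat_reduct L Y X.
Proof.
move=> eqSM cY XY.
have [S [oL oM]] := over_exists2 L M.
rewrite (sat_reduct_restr _ _ oL) (sat_reduct_restr _ _ oM).
have [B _ BX] := sub_fsetP (@subIsetr _ X [set` S]).
have [D _ DY] := sub_fsetP (@subIsetr _ Y [set` S]).
rewrite BX DY.
have BD : [set` B] `<=` [set` D] by rewrite -BX -DY; exact: setSI.
have cD : consistent [set` D] by rewrite -DY; apply: consistent_sub cY.
have [DB|DB] := pselect ([set` D] `<=` [set` B]).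
  move=> _; suff -> : [set` B] = [set` D] by exact: sat_reduct_refl.
  by rewrite eqEsubset.
move=> satM; apply: contrapT => nsatL.
have pBD : [set` B] `<` [set` D] by [].
have /eqSM := (SM_facts_impls L cD pBD).2 nsatL.
by move=> /(SM_facts_impls _ cD pBD).
Qed.

Lemma SM_punion_LSE_eq L M :
  (forall N, SM (punion L N) = SM (punion M N)) -> LSE L = LSE M.
Proof.
move=> eqSM; rewrite eqEsubset; split => -[X Y] /LSE_P[cY XY sat]; apply/LSE_P;
  split => //; apply: SM_punion_sat_reduct sat => // N; by rewrite eqSM.
Qed.

End SEModels.

(** * Limits of normalized exponentials with affine exponents *)

Section Limits.
Variables (R : realType) (T : choiceType) (C : set T).
Implicit Types (s t h : T -> R).

Local Notation expRatio s h X :=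
  (fun alpha => expR (s X + h X * alpha) /
                \sum_(Y \in C) expR (s Y + h Y * alpha)).

Lemma le_fsum_expR (f : T -> R) X : finite_set C -> C X ->
  expR (f X) <= \sum_(Y \in C) expR (f Y).
Proof.
move=> finC CX; rewrite (fsbigD1 X)//= lerDl.
by apply: fsumr_ge0 => Y _; exact: expR_ge0.
Qed.

(** Keeping only the term of [Y] in the denominator bounds the ratio by a constant times
    [expR (- (d * alpha))], where [d] is the positive difference of slopes. *)
Lemma lim_expRatio_eq0 s h X Y : finite_set C -> C Y -> h X < h Y ->
  lim (expRatio s h X alpha @[alpha --> +oo]) = 0.
Proof.
move=> finC CY hXY; apply: cvg_lim => //.
pose d := h Y - h X.
have bound : (fun alpha => expR (s X - s Y) * expR (- (d * alpha))) alpha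
    @[alpha --> +oo] --> 0.
  rewrite -(mulr0 (expR (s X - s Y))); apply: cvgMl_tmp.
  apply: (@cvg_comp _ _ _ (fun alpha => d * alpha) (fun x => expR (- x)));
    last exact: cvgr_expR.
  by apply: gt0_cvgMry; [rewrite subr_gt0|exact: cvg_id].
apply: (squeeze_cvgr _ (cvg_cst 0) bound); apply: nearW => alpha.
have le_sum := le_fsum_expR (fun Z => s Z + h Z * alpha) finC CY.
have sum_gt0 := lt_le_trans (expR_gt0 _) le_sum.
rewrite divr_ge0 ?expR_ge0 ?(ltW sum_gt0)//= ler_pdivrMr// -expRD.
apply: le_trans (ler_wpM2l (expR_ge0 _) le_sum).
by rewrite -expRD ler_expR /d; lra.
Qed.

Lemma expRatio_cst s h (a : R) X : (forall Y, C Y -> h Y = a) -> C X ->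
  expRatio s h X = fun=> expR (s X) / \sum_(Y \in C) expR (s Y).
Proof.
move=> ha CX; apply/funext => alpha.
rewrite ha//.
under eq_fsbigr => Y /[!inE] CY do rewrite ha// expRD mulrC.
by rewrite -mulr_fsumr expRD invfM mulrA mulfK// gt_eqF ?expR_gt0.
Qed.

(** Equal slopes [g] make all limits positive; a non-maximal slope in [h] would give limit 0, so [h]
    is constant as well. Both ratios then are constant in alpha and can be compared directly. *)
Lemma lim_expRatio_inj s t g h (a : R) :
  finite_set C -> (forall X, C X -> g X = a) ->
  (forall X, C X -> lim (expRatio s g X alpha @[alpha --> +oo]) =
                    lim (expRatio t h X alpha @[alpha --> +oo])) ->
  forall X Y, C X -> C Y -> h X = h Y /\ s X - t X = s Y - t Y.
Proof.
move=> finC ga eq_lim.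
have sum_gt0 f X : C X -> 0 < \sum_(Y \in C) expR (f Y) :> R.
  by move=> CX; apply: lt_le_trans (expR_gt0 (f X)) (le_fsum_expR _ finC CX).
have le_h X Y : C X -> C Y -> h Y <= h X.
  move=> CX CY; rewrite leNgt; apply/negP => hXY; have := eq_lim X CX.
  rewrite (lim_expRatio_eq0 t finC CY hXY) (expRatio_cst _ ga)// lim_cst//.
  by apply/eqP; rewrite gt_eqF// divr_gt0 ?expR_gt0// (sum_gt0 s X).
have eq_h X Y : C X -> C Y -> h X = h Y.
  by move=> CX CY; apply/eqP; rewrite eq_le !le_h.
move=> X Y CX CY; split; first exact: eq_h.
(* The quotient of the two normalizing sums does not depend on [Z]. *)
have ratio Z : C Z -> expR (s Z - t Z) =
    (\sum_(Y \in C) expR (s Y)) / \sum_(Y \in C) expR (t Y).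
  move=> CZ; have := eq_lim Z CZ.
  rewrite (expRatio_cst s ga)//.
  rewrite (expRatio_cst t (h := h) (a := h Z))//; last first.
    by move=> ? ?; apply: eq_h.
  have sum_neq0 f : \sum_(Y \in C) expR (f Y) != 0 :> R.
    by rewrite gt_eqF// (sum_gt0 f Z).
  have exp_neq0 (x : R) : expR x != 0 by rewrite gt_eqF ?expR_gt0.
  rewrite !lim_cst// => /eqP; rewrite eqr_div// => /eqP ratio_eq.
  by rewrite expRB; apply/eqP; rewrite eqr_div// ratio_eq mulrC.
by apply: expR_inj; rewrite !ratio.
Qed.

End Limits.

(** * Soft and hard parts of a weight *)

Section Weights.
Variables (R : realType) (A : choiceType).
Implicit Types (L M N : program R A) (X Y : set (literal A)).

(** Constant term of the exponent of [W (restr M X)], which is affine in alpha; the default 0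
    discards the hard rules. *)
Definition soft M X : R :=
  \sum_(wr <- enum_mset M | `[< satisfies X wr.2 >]) odflt 0 wr.1.

(** Slope of the same exponent, kept in [nat] so that it can serve as a multiplicity in
    [balance]. *)
Definition hard M X : nat :=
  (\sum_(wr <- enum_mset M | `[< satisfies X wr.2 >]) (wr.1 == None))%N.

Lemma W_restr M X alpha :
  W (restr M X) alpha = expR (soft M X + (hard M X)%:R * alpha).
Proof.
rewrite /W (perm_big _ (perm_eq_seq_mset _)) big_filter; congr expR.
rewrite /hard natr_sum mulr_suml -big_split/=; apply: eq_bigr => -[[w|] r] _ /=.
  by rewrite mul0r addr0.
by rewrite mul1r add0r.
Qed.

Lemma soft_punion L M X : soft (punion L M) X = soft L X + soft M X.
Proof. by rewrite /soft (perm_big _ (perm_punion L M)) big_cat. Qed.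

Lemma hard_punion L M X : hard (punion L M) X = (hard L X + hard M X)%N.
Proof. by rewrite /hard (perm_big _ (perm_punion L M)) big_cat. Qed.

Lemma W_punion L M X alpha :
  W (restr (punion L M) X) alpha = W (restr L X) alpha * W (restr M X) alpha.
Proof.
rewrite !W_restr soft_punion hard_punion natrD -expRD; congr expR; ring.
Qed.

Lemma weight_restr (S : {fset literal A}) M X : over S M ->
  soft M X = soft M (X `&` [set` S]) /\ hard M X = hard M (X `&` [set` S]).
Proof.
move=> oM; split; rewrite /soft /hard big_seq_cond [RHS]big_seq_cond;
  apply: eq_bigl => wr; case wrM : (wr \in _) => //=;
  apply: asbool_equiv_eq; exact: satisfies_restr (oM _ wrM).
Qed.

End Weights.

(** * Extensions that equalize the number of satisfied hard rules *)

Section Balance.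
Variables (R : realType) (A : choiceType).
Implicit Types (L M N : program R A) (X Y : set (literal A)).
Implicit Types (S B Z : {fset literal A}) (n : {fset literal A} -> nat).

(* The constraint violated by [Z] only, among the subsets of [S]. *)
Definition block S Z : rule A := (fset0, Z, S `\` Z)%fset.

(** Copies count in a multiset, so violating [block S Z] costs [Z] exactly [n Z] hard rules. *)
Definition balance S n : program R A :=
  seq_mset (facts R S ++
            flatten [seq nseq (n Z) (None, block S Z) | Z <- fpowerset S]).

Lemma mem_balance S n (wr : wrule R A) : wr \in enum_mset (balance S n) ->
  (exists2 l, l \in S & wr = (Some 0, fact l)) \/
  (exists2 Z, (Z `<=` S)%fset & wr = (None, block S Z)).
Proof.
rewrite mem_seq_mset mem_cat => /orP[/mapP[l lS ->]|/flatten_mapP[Z ZS]].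
  by left; exists l.
by rewrite mem_nseq => /andP[_ /eqP ->]; right; exists Z; rewrite -?fpowersetE.
Qed.

Lemma satisfies_block S B Z : (B `<=` S)%fset -> (Z `<=` S)%fset ->
  satisfies [set` B] (block S Z) <-> B != Z.
Proof.
move=> /fsubsetP BS /fsubsetP ZS; split => [satB|/eqP BZ /= ZB disj].
  apply/negP => /eqP BZ; have [|| l []//] := satB.
  - by rewrite BZ.
  - by rewrite BZ -subset0 => l /= [] /fsetDP[_ /negP].
exfalso; apply: BZ; apply/fsetP => l; apply/idP/idP => [lB|]; last exact: ZB.
apply/negPn/negP => nlZ; suff : set0 l by [].
by rewrite -disj; split => //=; apply/fsetDP; split => //; exact: BS.
Qed.

Lemma over_balance S n : over S (balance S n).
Proof.
move=> wr /mem_balance[[l lS ->]|[Z /fsubsetP ZS ->]] m;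
  rewrite /rule_lits !in_fsetU !in_fset0 ?orbF ?orFb /=.
  by move=> /fset1P ->.
by case/orP => [/ZS//|/fsetDP[]].
Qed.

Lemma soft_balance S n X : soft (balance S n) X = 0.
Proof.
by apply: big1_seq => wr /andP[_ /mem_balance[[l _ ->]|[Z _ ->]]].
Qed.

(** The facts are soft, and among the constraints [B] violates only the [n B] copies of its own. *)
Lemma hard_balance S n B : (B `<=` S)%fset ->
  (n B + hard (balance S n) [set` B] = \sum_(Z <- fpowerset S) n Z)%N.
Proof.
move=> BS; rewrite /hard (perm_big _ (perm_eq_seq_mset _)) big_cat/=.
rewrite big1_seq ?add0n; last by move=> wr /andP[_ /mapP[l _ ->]].
rewrite big_flatten big_map [RHS](bigD1_seq B) ?fpowersetE ?fset_uniq//=.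
congr (_ + _)%N.
rewrite [RHS]big_mkcond; apply: eq_big_seq => Z; rewrite fpowersetE => ZS.
rewrite big_nseq_cond/= (asbool_equiv_eq (satisfies_block BS ZS)) asboolb eq_sym.
by case: ifP => // _; elim: (n Z) => //= ? ->.
Qed.

(** Facts outside [Y] are violated by [Y] and leave the restricted program; those in [Y] stay and
    exclude every proper subset. *)
Lemma SM_balance S n M : over S M ->
  SM (punion M (balance S n)) = [set Y | consistent Y /\ Y `<=` [set` S]].
Proof.
move=> oM; rewrite eqEsubset; split => Y.
  move=> SMY; split; first by case/SM_P: SMY.
  exact: SM_sub (over_punion oM (@over_balance _ _)) SMY.
move=> [cY YS]; apply/SM_P; split => // X [_ nYX].
case/sat_reduct_punion => _ /sat_reductP satX.
apply: nYX => l Yl; apply/set1_meets; apply: (satX (Some 0, fact l)).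
- by rewrite mem_seq_mset mem_cat map_f//; exact: YS.
- exact: satisfies_fact.
- exact: fset0_meets.
- by rewrite set_fset0.
Qed.

Lemma eq_lim (f g : R -> R) (F : set_system R) :
  f =1 g -> lim (f x @[x --> F]) = lim (g x @[x --> F]).
Proof. by move=> /funext ->. Qed.

Lemma PsmE M X : Psm M X =
  lim (expR (soft M X + (hard M X)%:R * alpha) /
       (\sum_(Y \in SM M) expR (soft M Y + (hard M Y)%:R * alpha))
       @[alpha --> +oo]).
Proof.
apply: eq_lim => alpha; rewrite /Wsm W_restr.
by congr (_ / _); apply: eq_fsbigr => Y _; rewrite W_restr.
Qed.

(** * Necessity of the weight conditions *)

Lemma p_strong_weights L M : p_strong_equiv L M ->
  exists c k : R, se_weights_proportional L M c k.
Proof.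
have [S [oL oM]] := over_exists2 L M.
(* The multiplicities give all stable models of [punion L N] the same number of
   satisfied hard rules, so that all of them have positive probability. *)
set N := balance S (fun Z => hard L [set` Z]) => /(_ N)[eqSM eqP].
pose T := (\sum_(Z <- fpowerset S) hard L [set` Z])%N.
have SML := SM_balance (fun Z => hard L [set` Z]) oL; rewrite -/N in SML.
have finC : finite_set (SM (punion L N)).
  exact: finite_SM (over_punion oL (@over_balance _ _)).
have hardL Y : SM (punion L N) Y -> (hard (punion L N) Y)%:R = T%:R :> R.
  rewrite SML => -[_ YS]; rewrite hard_punion.
  have [B BS ->] := sub_fsetP YS.
  by congr _%:R; exact: hard_balance.
have eqlim Y (SY : SM (punion L N) Y) :=
  etrans (esym (PsmE _ Y)) (etrans (eqP Y SY) (PsmE _ Y)).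
rewrite -eqSM in eqlim; have inj := lim_expRatio_inj finC hardL eqlim.
have S0 : SM (punion L N) set0 by rewrite SML; split => // a [].
(* The empty set, always stable here, is the reference point that fixes both constants. *)
exists (soft L set0 - soft M set0), ((hard L set0)%:R - (hard M set0)%:R).
move=> [X Y] /LSE_P[cY _ _] alpha.
rewrite /Wse /= !W_restr.
have [-> ->] := weight_restr Y oL; have [-> ->] := weight_restr Y oM.
set Y' := Y `&` _.
have SY : SM (punion L N) Y'.
  rewrite SML.
  by split; [exact: consistent_sub (@subIsetl _ _ _) cY|exact: subIsetr].
(* Both hard counts, for [L] and for [M] extended by [N], agree at [Y'] and at the empty set;
   subtracting them eliminates the share of [N]. *)
have [] := inj _ _ SY S0; have := hardL _ SY; have := hardL _ S0.
rewrite !hard_punion !soft_punion !soft_balance !natrD => h1 h2 h3 h4.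
rewrite -expRD; congr expR.
have -> : soft L Y' = soft L set0 - soft M set0 + soft M Y' by lra.
have -> : (hard L Y')%:R =
    (hard L set0)%:R - (hard M set0)%:R + (hard M Y')%:R :> R by lra.
ring.
Qed.

(** Weights are compared without normalization, so the facts alone (multiplicity 0) suffice; the
    positive weight of the extension cancels. *)
Lemma w_strong_weights L M : w_strong_equiv L M ->
  se_weights_proportional L M 0 0.
Proof.
have [S [oL oM]] := over_exists2 L M.
move=> /(_ (balance S (fun=> 0%N)))[_ eqW] [X Y] /LSE_P[cY _ _] alpha.
rewrite mul0r addr0 expR0 mul1r /Wse /= !W_restr.
have [-> ->] := weight_restr Y oL; have [-> ->] := weight_restr Y oM.
rewrite -!W_restr; set Y' := Y `&` _.
have SY : SM (punion L (balance S (fun=> 0%N))) Y'.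
  rewrite SM_balance//.
  by split; [exact: consistent_sub (@subIsetl _ _ _) cY|exact: subIsetr].
have /(congr1 (@^~ alpha)) := eqW _ SY; rewrite /Wsm !W_punion.
by apply: mulIf; rewrite gt_eqF// expR_gt0.
Qed.

(** * Sufficient conditions for p-strong equivalence *)

Lemma w_strong_p_strong L M : w_strong_equiv L M -> p_strong_equiv L M.
Proof.
move=> wLM N; have [eqSM eqW] := wLM N; split => // X SX.
rewrite /Psm -eqSM eqW//.
apply: eq_lim => alpha; congr (_ / _).
by apply: eq_fsbigr => Y; rewrite inE => SY; rewrite eqW.
Qed.

(** A stable model [X] is consistent, so proportionality applies to the SE-model [(X, X)] of [L];
    weights are multiplicative over [punion]. *)
Lemma LSE_weights L M N c k X : se_weights_proportional L M c k ->
  SM (punion L N) X ->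
  Wsm (punion L N) X =
  (fun alpha => expR (c + k * alpha) * Wsm (punion M N) X alpha).
Proof.
move=> prop /SM_P[cX _]; apply/funext => alpha; rewrite /Wsm !W_punion mulrA.
by congr (_ * _); exact: (prop (X, X) (LSE_diag L cX)).
Qed.

Lemma LSE_p_strong L M c k : LSE L = LSE M ->
  se_weights_proportional L M c k -> p_strong_equiv L M.
Proof.
move=> eqLSE prop N.
have eqSM : SM (punion L N) = SM (punion M N).
  by rewrite eqEsubset; split; apply: SM_punion_LSE.
split => // X SX; rewrite /Psm -eqSM (LSE_weights prop SX).
apply: eq_lim => alpha.
under eq_fsbigr => Y /[!inE] SY do rewrite (LSE_weights prop SY).
by rewrite -mulr_fsumr -mulf_div divff ?mul1r// gt_eqF ?expR_gt0.
Qed.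

End Balance.

Theorem theorem1 (R : realType) (A : choiceType) (L M : program R A) :
  (p_strong_equiv L M <->
     LSE L = LSE M /\ exists c k : R, se_weights_proportional L M c k) /\
  (w_strong_equiv L M <->
     p_strong_equiv L M /\ se_weights_proportional L M 0%R 0%R).
Proof.
have p_LSE : p_strong_equiv L M -> LSE L = LSE M.
  by move=> pLM; apply: SM_punion_LSE_eq => N; case: (pLM N).
split; split.
- by move=> pLM; split; [exact: p_LSE|exact: p_strong_weights].
- by case=> eqLSE [c [k prop]]; exact: LSE_p_strong prop.
- by move=> wLM; split; [exact: w_strong_p_strong|exact: w_strong_weights].
move=> [pLM prop] N; have [eqSM _] := pLM N; split => // X SX.
rewrite (LSE_weights prop SX).
by apply/funext => alpha; rewrite mul0r addr0 expR0 mul1r.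
Qed.
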